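(* For every integer $m\ge2$, $$2^{m-2}\,\Psi^w_{\mathbb{Z}_{2^m}}(x)=\sum_{t=0}^{m-2}\phi(2^t)\left(\left(1+x^{2^{t+1}}\right)^{2^{m-t-2}}-1\right)(1+x)\prod_{s=t+1}^{m-2}(1+x^2)^{2^{m-s-2}}\prod_{s=1}^{t}\left(1+x^{2^{t-s+1}}\right)^{2^{m-t-2}},$$ and hence $$\mathcal{E}^w(\mathbb{Z}_{2^m})=\Psi^w_{\mathbb{Z}_{2^m}}(1)=\frac{1}{2^{m-2}}\sum_{t=0}^{m-2}\phi(2^t)\left(2^{1+2^{m-t-2}}-2\right)\prod_{s=t+1}^{m-2}2^{2^{m-s-2}}\prod_{s=1}^{t}2^{2^{m-t-2}},$$ where $\phi$ is Euler's totient function and an empty product equals $1$.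
   Context: For a finite group $\mathcal{A}$ with identity $e$, let $G(\mathcal{A})=\{\Omega\subseteq\mathcal{A}:\Omega^{-1}=\Omega,\ \langle\Omega\rangle=\mathcal{A},\ e\notin\Omega\}$. $\mathrm{Aut}(\mathcal{A})$ acts on $G(\mathcal{A})$ by $\alpha\cdot\Omega=\alpha(\Omega)$. For $k\ge1$ let $a^w_k(\mathcal{A})$ be the number of orbits of $\mathrm{Aut}(\mathcal{A})$ on $\{\Omega\in G(\mathcal{A}):|\Omega|=k\}$ (the number of weak equivalence classes of Cayley graphs $C(\mathcal{A},\Omega)$ of degree $k$); $\Psi^w_{\mathcal{A}}(x)=\sum_{k=1}^{|\mathcal{A}|-1}a^w_k(\mathcal{A})x^k$ and $\mathcal{E}^w(\mathcal{A})=\Psi^w_{\mathcal{A}}(1)$. For cyclic groups $\mathbb{Z}_n$, $\mathrm{Aut}(\mathbb{Z}_n)$ consists of multiplications by units mod $n$. *)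

(* Defs.v *)
From HB Require Import structures.
From mathcomp Require Import all_boot all_order all_algebra all_fingroup all_solvable.
Set Implicit Arguments. Unset Strict Implicit. Unset Printing Implicit Defensive.
Import GRing.Theory.

Definition Gsets (gT : finGroupType) : {set {set gT}} :=
  [set O : {set gT} | [&& (O^-1 == O)%g, (<<O>> == [set: gT])%g & (1%g \notin O)]].

Definition aut_orbit (gT : finGroupType) (O : {set gT}) : {set {set gT}} :=
  [set (fun x => (a : {perm gT}) x) @: O | a in Aut [set: gT]%g].

Definition awk (gT : finGroupType) (k : nat) : nat :=
  #|[set aut_orbit O | O in [set O in Gsets gT | #|O| == k]]|.

Definition Psiw (gT : finGroupType) : {poly int} :=
  \sum_(1 <= k < #|gT|) (awk gT k)%:R *: 'X^k.

Definition Ew (gT : finGroupType) : nat := \sum_(1 <= k < #|gT|) awk gT k.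

(* Main.v *)
(** Two sets are weakly equivalent exactly when they lie in one orbit of [Aut], so by the
    Frobenius-Cauchy lemma applied degree by degree, [|Aut| * Psi] is the sum, over the
    automorphisms [a], of ['X^|O|] over the generating symmetric sets [O] fixed by [a].
    In a cyclic group of order [2^m], [Aut = <[s]> \x <[t]>] with [t] the inversion and
    [s] the power map [x |-> x^5]; symmetric sets are the [t]-stable ones, so [a] may be
    taken in [<[s]>] at the price of a factor 2, and the sets to be counted are the unions
    of [<a, t>]-orbits that contain an element of order [2^m].  The orbit of an element of
    order [2^e] only depends on [e] and on the order of [a], because its stabiliser in
    [Aut] is, for [e >= 2], the unique subgroup of [<[s]>] of order [2^(m - e)]. *)
Require Import Defs.
From HB Require Import structures.
From mathcomp Require Import all_boot all_order all_algebra all_fingroup all_solvable.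
From mathcomp Require Import zify.
Import GRing.Theory.
Local Open Scope group_scope.
Local Open Scope ring_scope.

(** * Subsets stable under a group action, weighted by size *)

Lemma prodr_1D_subsets (R : comNzRingType) (I : finType) (P : {set I}) (F : I -> R) :
  \prod_(i in P) (1 + F i) = \sum_(J : {set I} | J \subset P) \prod_(i in J) F i.
Proof.
rewrite big_mkcond /=.
(* A summand 0 outside [P] lets the product run over all of [I]; subsets that leave [P] then
   vanish. *)
under eq_bigr => i _.
  rewrite (_ : (if _ then _ else _) = (if i \in P then F i else 0) + 1); last first.
    by case: ifP => _; rewrite ?add0r // addrC.
  over.
rewrite bigA_distr [RHS]big_mkcond /=; apply: eq_bigr => J _.
rewrite -[in LHS]big_mkcond /=; case: ifPn => [/subsetP sJP | /subsetPn[i Ji nPi]].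
  by apply: eq_bigr => i /sJP ->.
by rewrite (bigD1 i) //= (negPf nPi) mul0r.
Qed.

Lemma cover_orbits_acts {aT : finGroupType} {T : finType} {to : {action aT &-> T}}
    {H : {group aT}} {O : {set T}} :
  (cover (orbit to H @: O) == O) = [acts H, on O | to].
Proof.
apply/eqP/idP => [defO | /orbit_partition/cover_partition //].
apply/actsP => a Ha x.
have key y b : b \in H -> y \in O -> to y b \in O.
  move=> Hb; rewrite -[in X in X -> _]defO => /bigcupP[_ /imsetP[z Oz ->] zy].
  rewrite -defO; apply/bigcupP; exists (orbit to H z); first exact: imset_f.
  by apply: (orbit_trans _ zy); apply: mem_orbit.
apply/idP/idP => [|/key->//]; rewrite -{2}(actK to a x).
by move/key=> -> //; rewrite groupV.
Qed.

(** A stable subset of [S] is a union of orbits in [S]: [cover] and [O |-> orbit to H @: O] are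
    inverse bijections with families of orbits. Sizes add up over the disjoint orbits, and the
    product expands over such families. *)
Lemma sum_stable_subsets {aT : finGroupType} {T : finType} (to : {action aT &-> T})
    (H : {group aT}) (S : {set T}) (R : comNzRingType) (z : R) :
    [acts H, on S | to] ->
  \sum_(O : {set T} | (O \subset S) && [acts H, on O | to]) z ^+ #|O| =
    \prod_(B in orbit to H @: S) (1 + z ^+ #|B|).
Proof.
move=> actsS; rewrite prodr_1D_subsets.
have coverK (J : {set {set T}}) : J \subset orbit to H @: S ->
    orbit to H @: cover J = J.
  move/subsetP=> sJ; apply/setP=> B; apply/imsetP/idP => [[x /bigcupP[C JC Cx] ->] | JB].
    by have /imsetP[y _ defC] := sJ C JC; move: Cx (JC); rewrite defC => /orbit_eqP->.
  have /imsetP[y _ defB] := sJ B JB; exists y => //.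
  by apply/bigcupP; exists B => //; rewrite defB orbit_refl.
rewrite [RHS](reindex_onto (fun O : {set T} => orbit to H @: O) cover) => [|J /coverK //].
apply: eq_big => [O | O /andP[_ actsO]].
  rewrite cover_orbits_acts; case: (boolP [acts H, on O | to]); rewrite ?andbF ?andbT //.
  move=> actsO; apply/idP/idP => [sOS | /subsetP sOS]; first exact: imsetS.
  apply/subsetP=> x Ox; have /imsetP[y Sy eqxy] := sOS _ (imset_f _ Ox).
  by rewrite -(acts_sub_orbit _ actsS) eqxy acts_sub_orbit.
by rewrite -expr_sum (card_partition (orbit_partition actsO)).
Qed.

(** * Burnside counting on generating symmetric sets *)

Lemma AutT_imset_gen (gT : finGroupType) (a : {perm gT}) (O : {set gT}) :
  a \in Aut [set: gT] -> (<<a @: O>> = a @: <<O>>)%g.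
Proof.
move=> Aa; have im B : (autm_morphism Aa @* B)%g = a @: B.
  by rewrite morphimEsub ?subsetT //; apply: eq_imset; apply: autmE.
by rewrite -!im morphim_gen ?subsetT.
Qed.

Lemma AutTX (gT : finGroupType) (a : {perm gT}) n :
  a \in Aut [set: gT] -> {morph a : x / (x ^+ n)%g}.
Proof. by move=> Aa x; rewrite -(autmE Aa) morphX ?inE. Qed.

Lemma AutTV (gT : finGroupType) (a : {perm gT}) :
  a \in Aut [set: gT] -> {morph a : x / (x^-1)%g}.
Proof. by move=> Aa x; rewrite -(autmE Aa) morphV ?inE. Qed.

Lemma Gsets_acts (gT : finGroupType) k :
  [acts Aut [set: gT], on [set O in Gsets gT | #|O| == k] | 'P^*].
Proof.
apply/subsetP=> a Aa; rewrite !inE; apply/subsetP=> O; rewrite !inE.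
case/andP=> /and3P[/eqP OV /eqP genO nO1] /eqP cardO.
have -> : ('P^*)%act O a = a @: O by [].
apply/andP; split; last by rewrite card_imset ?cardO //; apply: perm_inj.
have a1 : a 1%g = 1%g by rewrite -(autmE Aa) morph1.
apply/and3P; split.
- rewrite eqEcard card_invg leqnn andbT; apply/subsetP=> x; rewrite inE.
  case/imsetP=> y Oy defx; apply/imsetP; exists y^-1%g; first by rewrite -OV inE invgK.
  by rewrite AutTV // -defx invgK.
- by rewrite AutT_imset_gen // genO eqEcard subsetT card_imset ?leqnn //; apply: perm_inj.
- apply: contra nO1 => /imsetP[y Oy y1].
  by have /perm_inj-> : a 1%g = a y by rewrite a1.
Qed.

(** Ensures that the degree range in [Psiw] misses no set: the empty set generates only the trivial
    group, and the full set contains 1. *)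
Lemma card_Gsets (gT : finGroupType) (O : {set gT}) :
  (1 < #|gT|)%N -> O \in Gsets gT -> (0 < #|O| < #|gT|)%N.
Proof.
move=> gT_gt1; rewrite inE => /and3P[_ genO nO1]; apply/andP; split.
  rewrite card_gt0; apply: contraTneq genO => ->.
  by rewrite gen0 eq_sym; apply: contraL gT_gt1 => /eqP/setP g1;
     rewrite -cardsT (eq_card g1) cards1.
rewrite ltn_neqAle max_card andbT; apply: contraNneq nO1 => cardO.
have eO : O == setT by rewrite eqEcard subsetT cardsT cardO leqnn.
by rewrite (eqP eO) inE.
Qed.

Lemma Psiw_burnside (gT : finGroupType) : (1 < #|gT|)%N ->
  #|Aut [set: gT]|%:R * Psiw gT =
    \sum_(a in Aut [set: gT])
      \sum_(O in Gsets gT | ('P^*)%act O a == O) 'X^#|O| :> {poly int}.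
Proof.
move=> gT_gt1; rewrite /Psiw mulr_sumr.
transitivity (\sum_(a in Aut [set: gT]) \sum_(1 <= k < #|gT|)
    #|'Fix_([set O in Gsets gT | #|O| == k] | 'P^*)[a]|%:R *: 'X^k : {poly int}).
  rewrite exchange_big; apply: eq_bigr => k _; rewrite -scaler_suml -natr_sum.
  (* The orbits of ['P^*] unfold to [aut_orbit], so the number of orbits is [awk gT k] by
     conversion. *)
  rewrite (Frobenius_Cauchy (Gsets_acts gT k)) natrM -scalerA scaler_nat.
  by rewrite !scaler_nat mulr_natl -!mulrnA mulnC.
apply: eq_bigr => a Aa.
transitivity (\sum_(1 <= k < #|gT|) \sum_(O in Gsets gT | ('P^*)%act O a == O)
   (if #|O| == k then 'X^k else 0) : {poly int}).
  apply: eq_bigr => k _; rewrite -big_mkcondr sumr_const scaler_nat; congr (_ *+ _).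
  apply: eq_card => O; rewrite !inE sub1set !inE.
  by rewrite [RHS]unfold_in !inE andbAC.
rewrite exchange_big; apply: eq_bigr => O /andP[GO _].
rewrite (bigD1_seq #|O|) ?iota_uniq ?mem_index_iota ?card_Gsets //= eqxx.
by rewrite big1 ?addr0 // => k; rewrite eq_sym => /negPf->.
Qed.

(** * Automorphisms of cyclic groups and their orbits *)

Lemma Aut_cyclic_2group_gens (gT : finGroupType) m :
    (1 < m)%N -> cyclic [set: gT] -> #|[set: gT]| = (2 ^ m)%N ->
  exists s t : {perm gT},
    [/\ #[s]%g = (2 ^ (m - 2))%N, #[t]%g = 2, (<[s]> \x <[t]>)%g = Aut [set: gT],
        forall x : gT, t x = x^-1%g & forall x, (#[x]%g %| 4)%N -> s x = x].
Proof.
move=> m_gt1 cycG oG.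
have pG : 2.-group [set: gT] by rewrite /pgroup oG pnatX.
have ntG : [set: gT] != 1%g.
  by rewrite -cardG_gt1 oG -{1}(expn0 2) ltn_exp2l // ltnW.
have [mu [[mu_act _ _ _ _] _]] := cyclic_pgroup_Aut_structure pG cycG ntG.
have -> : logn 2 #|[set: gT]%G| = m by rewrite oG pfactorK.
rewrite -subn1 /=.
have -> : (m - 1 == 0)%N = false by apply/eqP; lia.
case=> t [At ot mut].
have tV x : t x = x^-1%g.
  by rewrite -(mu_act t x At) ?inE // mut -[1]/(1%:R) expg_zneg ?inE // expg_znat ?inE.
(* For [m = 2] the inversion alone generates [Aut], and [s] is taken trivial. *)
case: ifPn => [/eqP m2 defA | _ [s [As os mus defA _]]].
  exists 1%g, t; split => // [||x _]; last by rewrite perm1.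
    by rewrite order1 (_ : (m - 2 = 0)%N) //; lia.
  by rewrite cycle1 dprod1g -defA.
exists s, t; split=> // [|x].
  by rewrite os; congr (2 ^ _)%N; lia.
(* Here [s] is the power map with exponent 5 = 4 + 1. *)
rewrite order_dvdn => /eqP x4.
by rewrite -(mu_act s x As) ?inE // mus expg_znat ?inE // (expgD x 4 1) x4 mul1g.
Qed.

(** These elements are the generators of the unique subgroup of order [d]. *)
Lemma card_order_cyclic {gT : finGroupType} {G : {group gT}} {d} :
  cyclic G -> (d %| #|G|)%N -> #|[set x in G | #[x]%g == d]| = totient d.
Proof.
move=> cycG; have /cyclicP[g defG] := cycG; rewrite defG -orderE => dvd_d.
pose y := (g ^+ (#[g]%g %/ d))%g.
have oy : #[y]%g = d by rewrite orderXdiv ?dvdn_div // divnA // mulKn ?order_gt0.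
rewrite -{2}oy totient_gen; apply: eq_card => x; rewrite !inE /generator.
have Gy : y \in G by rewrite defG mem_cycle.
apply/andP/eqP => [[Gx /eqP ox] | eqyx].
  apply/eqP; rewrite (eq_subG_cyclic cycG) ?cycle_subG //; last by rewrite defG.
  by rewrite -!orderE oy ox.
by rewrite orderE -eqyx -orderE oy eqxx -cycle_subG -eqyx cycle_subG mem_cycle.
Qed.

Lemma AutT_order (gT : finGroupType) (a : {perm gT}) x :
  a \in Aut [set: gT] -> #[a x]%g = #[x]%g.
Proof.
by move=> Aa; rewrite -(autmE Aa) order_injm ?inE ?injm_autm.
Qed.

(** By counting: an automorphism fixing [g] is trivial, so the orbit of [g] has as many elements as
    [Aut], namely the totient of [#[g]], which is also the number of elements of that order. *)
Lemma Aut_generator_orbit {gT : finGroupType} {g y : gT} :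
    [set: gT] = <[g]>%g -> #[y]%g = #[g]%g ->
  exists2 a, a \in Aut [set: gT] & a g = y.
Proof.
move=> defG oy; have cycG : cyclic [set: gT] by rewrite defG cycle_cyclic.
pose L := [set x in [set: gT] | #[x]%g == #[g]%g].
have oL : #|L| = totient #[g]%g by apply: (card_order_cyclic cycG); rewrite order_dvdG ?inE.
suff /imsetP[a Aa ->] : y \in orbit 'P (Aut [set: gT]) g by exists a.
suff -> : orbit 'P (Aut [set: gT]) g = L by rewrite !inE oy eqxx.
apply/eqP; rewrite eqEcard; apply/andP; split.
  by apply/subsetP=> _ /imsetP[a Aa ->]; rewrite !inE /= apermE AutT_order.
rewrite card_orbit (_ : 'C_(_)[g | 'P] = 1)%g; last first.
  apply/trivgP/subsetP=> a /setIP[Aa /astab1P ag]; rewrite inE; apply/eqP/permP=> x.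
  have /cycleP[i ->] : x \in <[g]>%g by rewrite -defG inE.
  by rewrite AutTX // -apermE ag perm1.
by rewrite indexg1 card_Aut_cyclic // oL orderE -defG leqnn.
Qed.

(** Elements of equal order generate the same subgroup, hence are powers [x0 ^+ k] of one
    representative. For a nontrivial element [k] is prime to [p], so [g |-> g ^+ k] is an
    automorphism carrying [x0] to it. *)
Lemma Aut_cyclic_pgroup_orbit (gT : finGroupType) p (x : gT) :
    prime p -> cyclic [set: gT] -> p.-group [set: gT] ->
  orbit 'P (Aut [set: gT]) x = [set y | #[y]%g == #[x]%g].
Proof.
move=> p_pr cycG pG; apply/eqP; rewrite eqEsubset; apply/andP; split.
  by apply/subsetP=> _ /imsetP[a Aa ->]; rewrite inE /= apermE AutT_order.
have /cyclicP[g defG] := cycG.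
have Gg z : z \in <[g]>%g by rewrite -defG inE.
have /cycleP[i defx] := Gg x.
pose d := gcdn #[g]%g i; pose x0 := (g ^+ d)%g.
have key z : #[z]%g = #[x]%g -> exists2 a, a \in Aut [set: gT] & a x0 = z.
  move=> oz; have ox0 : #[x0]%g = #[x]%g by rewrite defx !orderXgcd gcdnA gcdnn.
  have eqzx : <[x0]>%g = <[z]>%g.
    apply/eqP; rewrite (eq_subG_cyclic cycG) ?subsetT // -!orderE.
    by rewrite ox0 oz.
  have /cycleP[k defz] : z \in <[x0]>%g by rewrite eqzx cycle_id.
  (* The identity is set apart: being coprime to the order 1 would not make [k] prime to [p]. *)
  have [z1 | nz1] := eqVneq z 1%g.
    exists 1%g; rewrite ?group1 // perm1 z1; apply/eqP.
    by rewrite -order_eq1 ox0 -oz z1 order1.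
  have co : coprime #[x0]%g k by rewrite -generator_coprime -defz /generator eqzx.
  have cog : coprime #[g]%g k.
    have [e og] := p_natP pG; rewrite defG -orderE in og.
    have /(dvdn_pfactor _ _ p_pr) [f _ ox] : (#[x0]%g %| p ^ e)%N.
      by rewrite -og orderXdvd.
    rewrite ox in co; rewrite og; apply: coprimeXl; move: co; rewrite coprime_pexpl //.
    case: f ox => // /eqP; rewrite ox0 -oz order_eq1 => z1.
    by rewrite z1 in nz1.
  have [a Aa ag] := Aut_generator_orbit defG
    (esym (generator_order (etrans (generator_coprime g k) cog))).
  by exists a; rewrite // AutTX // ag defz -!expgM mulnC.
apply/subsetP=> y; rewrite inE => /eqP oy.
have [a Aa ax0] := key x erefl; have [b Ab bx0] := key y oy.
apply/imsetP; exists (a^-1 * b)%g; first by rewrite groupM ?groupV.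
by rewrite /= apermE permM -ax0 permK.
Qed.

(** * Stabilisers and orbit sizes in a cyclic 2-group *)

Lemma card_order_cyclic_2group {gT : finGroupType} {m} e :
    cyclic [set: gT] -> #|[set: gT]| = (2 ^ m)%N -> (0 < e <= m)%N ->
  #|[set x : gT | #[x]%g == (2 ^ e)%N]| = (2 ^ e.-1)%N.
Proof.
move=> cycG oG /andP[e_gt0 le_em].
have := card_order_cyclic cycG (d := (2 ^ e)%N).
rewrite oG dvdn_exp2l // totient_pfactor // mul1n => /(_ isT) <-.
by apply: eq_card => x; rewrite !inE.
Qed.

(** Orbit-stabiliser: [Aut] has order [2 ^ m.-1], and the orbit of [x] is the set of the [2 ^ e.-1]
    elements of its order. *)
Lemma card_Aut_astab1 {gT : finGroupType} {m e} {x : gT} :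
    cyclic [set: gT] -> #|[set: gT]| = (2 ^ m)%N -> #[x]%g = (2 ^ e)%N -> (0 < e)%N ->
  #|'C_(Aut [set: gT])[x | 'P]%g| = (2 ^ (m - e))%N.
Proof.
move=> cycG oG ox e_gt0.
have le_em : (e <= m)%N.
  by rewrite -(@dvdn_Pexp2l 2) // -ox -oG order_dvdG ?inE.
have := card_orbit_stab 'P [Aut [set: gT]] x.
rewrite (Aut_cyclic_pgroup_orbit _ 2) // /pgroup ?oG ?pnatX //.
rewrite ox (card_order_cyclic_2group _ cycG oG) ?e_gt0 // card_Aut_cyclic // oG.
rewrite totient_pfactor ?(leq_trans e_gt0) // mul1n.
rewrite (_ : m.-1 = e.-1 + (m - e))%N; last by lia.
by rewrite expnD => /eqP; rewrite eqn_pmul2l ?expn_gt0 // => /eqP.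
Qed.

(** Subgroups of 2-power order in a cyclic group are nested. *)
Lemma card_cyclic_2group_setI {gT : finGroupType} {G H K : {group gT}} {i j} :
    cyclic G -> H \subset G -> K \subset G ->
    #|H| = (2 ^ i)%N -> #|K| = (2 ^ j)%N ->
  #|(H :&: K)%g| = (2 ^ minn i j)%N.
Proof.
move=> cycG sHG sKG oH oK; have [leij | /ltnW leji] := leqP i j.
  have : H \subset K by rewrite -(cardSg_cyclic cycG) // oH oK dvdn_exp2l.
  by move/setIidPl->; rewrite oH.
have : K \subset H by rewrite -(cardSg_cyclic cycG) // oH oK dvdn_exp2l.
by move/setIidPr->; rewrite oK.
Qed.

(* Size of the orbit of an element of order [2 ^ e] under [<[a]> <*> <[t]>], #[a] = 2 ^ j.
   Truncated subtraction: with [s = m - e], the exponent [j - s] is [0] when [s >= j]. *)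
Definition orbit_size m j e := if e == 1%N then 1%N else (2 ^ (1 + (j - (m - e))))%N.

(** The group [H] generated by [a] and [t] has order [2 ^ j.+1]. For [e >= 2] the stabiliser of [x]
    in [H] is a subgroup of [<[a]>] of order [2 ^ minn j (m - e)], and the quotient is the orbit
    size. *)
Lemma card_orbit_cyclic_2group {gT : finGroupType} {m} {s t a : {perm gT}} {j} (x : gT) {e} :
    (1 < m)%N -> cyclic [set: gT] -> #|[set: gT]| = (2 ^ m)%N ->
    #[s]%g = (2 ^ (m - 2))%N -> #[t]%g = 2 -> (<[s]> \x <[t]>)%g = Aut [set: gT] ->
    (forall x : gT, (#[x]%g %| 4)%N -> s x = x) ->
    a \in <[s]>%g -> #[a]%g = (2 ^ j)%N -> #[x]%g = (2 ^ e)%N -> (0 < e)%N ->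
  #|orbit 'P (<[a]> <*> <[t]>) x| = orbit_size m j e.
Proof.
move=> m_gt1 cycG oG os ot defA s4 s_a oa ox e_gt0; rewrite /orbit_size.
have le_em : (e <= m)%N.
  by rewrite -(@dvdn_Pexp2l 2) // -ox -oG order_dvdG ?inE.
have [_ defst cst ti_st] := dprodP defA.
have sas : <[a]>%g \subset <[s]>%g by rewrite cycle_subG.
have cat : <[t]>%g \subset 'C(<[a]>)%g by rewrite (subset_trans cst) ?centS.
set H := (<[a]> <*> <[t]>)%G.
have defH : H = (<[a]> * <[t]>)%g :> {set _} by rewrite /= cent_joinEr.
have oH : #|H| = (2 ^ j.+1)%N.
  rewrite defH TI_cardMg -?orderE ?oa ?ot ?expnSr //.
  by apply/trivgP; rewrite -ti_st setSI.
have sHA : H \subset Aut [set: gT] by rewrite defH -defst mulSg.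
have sCH y : ('C_H[y | 'P] = H :&: 'C_(Aut [set: gT])[y | 'P])%g.
  by rewrite [RHS]setIA (setIidPl sHA).
have := card_orbit_stab 'P H x; rewrite oH.
have [e1 | e_neq1] := eqVneq e 1%N.
  (* The involution is unique, so all of [Aut] fixes it. *)
  have sH : H \subset 'C_(Aut [set: gT])[x | 'P]%g.
    rewrite (_ : 'C_(_)[x | 'P] = Aut [set: gT])%g //.
    apply/eqP; rewrite eqEcard subsetIl (card_Aut_astab1 cycG oG ox) //=.
    by rewrite card_Aut_cyclic // oG totient_pfactor ?(ltnW m_gt1) // mul1n e1 subn1.
  rewrite sCH (setIidPl sH) oH -{2}[(2 ^ _)%N]mul1n => /eqP.
  by rewrite eqn_pmul2r ?expn_gt0 // => /eqP.
have sCs : 'C_(Aut [set: gT])[x | 'P]%g \subset <[s]>%g.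
  (* A power of [x] of order 4: whatever fixes [x] fixes [y], and the stabiliser of [y] is [<[s]>],
     since [s] fixes [y] and the orders agree. *)
  pose y := (x ^+ (2 ^ (e - 2)))%g.
  have oy : #[y]%g = (2 ^ 2)%N by rewrite (orderXexp _ ox); congr (2 ^ _)%N; lia.
  rewrite (_ : <[s]>%g = 'C_(Aut [set: gT])[y | 'P]%g).
    apply/subsetP=> b /setIP[Ab /astab1P bx]; rewrite inE Ab; apply/astab1P.
    by rewrite /= apermE AutTX // -apermE bx.
  apply/eqP; rewrite eqEcard (card_Aut_astab1 cycG oG oy) // -orderE os leqnn andbT.
  rewrite cycle_subG inE -cycle_subG -defst mulG_subl; apply/astab1P.
  by rewrite /= apermE s4 ?oy.
have -> : 'C_H[x | 'P]%g = (<[a]> :&: 'C_(Aut [set: gT])[x | 'P])%g.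
  (* Dedekind's modular law, as [<[s]>] and [<[t]>] meet trivially. *)
  have Hs : (H :&: <[s]>)%g = <[a]>%g.
    by rewrite defH -group_modl // [X in (_ * X)%g]setIC ti_st mulg1.
  by rewrite sCH -{1}(setIidPr sCs) [LHS]setIA Hs.
rewrite (card_cyclic_2group_setI (cycle_cyclic s) sas sCs oa (card_Aut_astab1 cycG oG ox e_gt0)).
rewrite (_ : j.+1 = 1 + (j - (m - e)) + minn j (m - e))%N; last by lia.
by rewrite [in RHS]expnD => /eqP; rewrite eqn_pmul2r ?expn_gt0 // => /eqP.
Qed.

(** * Generating sets fixed by an automorphism *)

(** A set without an element of full order lies in the maximal subgroup [<[g ^+ p]>]. *)
Lemma cyclic_pgroup_gen {gT : finGroupType} {p m} (O : {set gT}) :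
    prime p -> (0 < m)%N -> cyclic [set: gT] -> #|[set: gT]| = (p ^ m)%N ->
  (<<O>>%g == [set: gT]) = [exists x in O, #[x]%g == (p ^ m)%N].
Proof.
move=> p_pr m_gt0 cycG oG; apply/idP/existsP => [genO | [x /andP[Ox /eqP ox]]]; last first.
  rewrite eqEcard subsetT oG -ox orderE subset_leq_card //.
  by rewrite cycle_subG mem_gen.
apply/existsP; apply: contraT => /existsPn noO.
have /cyclicP[g defG] := cycG.
have og : #[g]%g = (p ^ m)%N by rewrite orderE -defG.
have oK : #|<[g ^+ p]>%g| = (p ^ m.-1)%N.
  by rewrite -orderE -[p in (g ^+ p)%g]expn1 (orderXexp _ og) subn1.
have sOK : <<O>>%g \subset <[g ^+ p]>%g.
  rewrite gen_subG; apply/subsetP=> x Ox; move/(_ x): noO; rewrite Ox /= => nox.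
  have /(dvdn_pfactor _ _ p_pr)[e le_em ox] : (#[x]%g %| p ^ m)%N.
    by rewrite -oG order_dvdG ?inE.
  rewrite -cycle_subG -(cardSg_cyclic cycG) ?subsetT // oK -orderE ox dvdn_exp2l //.
  rewrite -ltnS prednK // ltn_neqAle le_em andbT.
  by apply: contraNneq nox => <-; rewrite ox.
have := subset_leq_card sOK; rewrite (eqP genO) oG oK leq_exp2l ?prime_gt1 //.
by rewrite leqNgt prednK // leqnn.
Qed.

(** The strict lower bound discards the identity. In a cyclic group of order [2 ^ m], [n = m] gives
    all other elements and [n = m.-1] those of the maximal subgroup. *)
Definition orders_upto (gT : finGroupType) n : {set gT} :=
  [set x : gT | (0 < logn 2 #[x]%g <= n)%N].

Lemma acts_orders_upto (gT : finGroupType) (H : {group {perm gT}}) n :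
  H \subset Aut [set: gT] -> [acts H, on orders_upto gT n | 'P].
Proof.
move=> sHA; apply/actsP=> a /(subsetP sHA) Aa x.
by rewrite !inE /= apermE AutT_order.
Qed.

(** Automorphisms preserve orders, so each orbit lies in one order class. The class of order [2 ^ e]
    has [2 ^ e.-1] elements and splits into orbits of equal size; the induction adds one class at a
    time. *)
Lemma prod_orbits_upto {gT : finGroupType} {m j} (H : {group {perm gT}})
    (R : comNzRingType) (z : R) n :
    cyclic [set: gT] -> #|[set: gT]| = (2 ^ m)%N -> (n <= m)%N ->
    H \subset Aut [set: gT] ->
    (forall (x : gT) e, #[x]%g = (2 ^ e)%N -> (0 < e)%N ->
       #|orbit 'P H x| = orbit_size m j e) ->
  \prod_(B in orbit 'P H @: orders_upto gT n) (1 + z ^+ #|B|) =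
  \prod_(1 <= e < n.+1)
     (1 + z ^+ orbit_size m j e) ^+ (2 ^ e.-1 %/ orbit_size m j e).
Proof.
move=> cycG oG le_nm sHA oorb; elim: n le_nm => [|n IHn] lt_nm.
  rewrite big_geq // (_ : orders_upto gT 0 = set0) ?imset0 ?big_set0 //.
  by apply/setP=> x; rewrite !inE; case: logn.
rewrite big_nat_recr //= -IHn ?(ltnW lt_nm) //.
pose L := [set x : gT | #[x]%g == (2 ^ n.+1)%N].
have order2 (x : gT) : {e | #[x]%g = (2 ^ e)%N}.
  exists (logn 2 #[x]%g); have : (#[x]%g %| 2 ^ m)%N by rewrite -oG order_dvdG ?inE.
  by case/(dvdn_pfactor _ _ (isT : prime 2)) => e _ ->; rewrite pfactorK.
have memL x : (x \in L) = (logn 2 #[x]%g == n.+1).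
  by have [e ox] := order2 x; rewrite inE ox pfactorK // eqn_exp2l.
have defD : orders_upto gT n.+1 = orders_upto gT n :|: L.
  by apply/setP=> x; rewrite in_setU memL !inE; lia.
have actsL : [acts H, on L | 'P].
  apply/actsP=> a /(subsetP sHA) Aa x.
  by rewrite !inE /= apermE AutT_order.
rewrite defD imsetU.
transitivity (\prod_(B in orbit 'P H @: orders_upto gT n) (1 + z ^+ #|B|) *
              \prod_(B in orbit 'P H @: L) (1 + z ^+ #|B|)).
  rewrite -bigU; first by apply: eq_bigl => B; rewrite !inE.
  rewrite -setI_eq0; apply/eqP/setP=> B; rewrite !inE; apply/andP=> -[].
  case/imsetP=> x Dx -> /imsetP[y Ly /orbit_eqP xy].
  have Lx := acts_in_orbit actsL xy Ly.
  by move: Dx; rewrite memL in Lx; rewrite inE (eqP Lx) ltnn andbF.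
congr (_ * _).
have unifL : {in orbit 'P H @: L, forall B : {set gT}, #|B| = orbit_size m j n.+1}.
  by move=> _ /imsetP[x /[!inE]/eqP ox ->]; apply: oorb.
rewrite (eq_bigr (fun=> 1 + z ^+ orbit_size m j n.+1)) => [|B /unifL-> //].
rewrite prodr_const; congr (_ ^+ _).
have := card_uniform_partition unifL (orbit_partition actsL).
rewrite (card_order_cyclic_2group _ cycG oG) ?lt_nm // => ->; rewrite mulnK //.
by rewrite /orbit_size; case: ifP; rewrite ?expn_gt0.
Qed.

(* The subtracted [1] removes the stable sets without an element of order [2 ^ m]. *)
Definition stable_weight (R : comNzRingType) m j (z : R) :=
  let f e := (1 + z ^+ orbit_size m j e) ^+ (2 ^ e.-1 %/ orbit_size m j e) in
  (f m - 1) * \prod_(1 <= e < m) f e.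

(** A symmetric set fixed by [a] is an [H]-stable one. Those avoiding 1 fail to generate exactly
    when they lie in [orders_upto gT m.-1], so the sum is a difference of two sums over stable
    subsets, each a product over orbits. *)
Lemma sum_fixed_Gsets {gT : finGroupType} {m} {s t a : {perm gT}} {j}
    (R : comNzRingType) (z : R) :
    (1 < m)%N -> cyclic [set: gT] -> #|[set: gT]| = (2 ^ m)%N ->
    #[s]%g = (2 ^ (m - 2))%N -> #[t]%g = 2 -> (<[s]> \x <[t]>)%g = Aut [set: gT] ->
    (forall x : gT, t x = x^-1%g) -> (forall x : gT, (#[x]%g %| 4)%N -> s x = x) ->
    a \in <[s]>%g -> #[a]%g = (2 ^ j)%N ->
  \sum_(O in Gsets gT | ('P^*)%act O a == O) z ^+ #|O| = stable_weight R m j z.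
Proof.
move=> m_gt1 cycG oG os ot defA tV s4 s_a oa.
have m_gt0 := ltnW m_gt1.
set H := (<[a]> <*> <[t]>)%G.
have [_ defst _ _] := dprodP defA.
have sHA : H \subset Aut [set: gT].
  rewrite join_subG -defst mulG_subr andbT.
  by rewrite (subset_trans _ (mulG_subl _ _)) ?cycle_subG.
have oorb (x : gT) e : #[x]%g = (2 ^ e)%N -> (0 < e)%N -> #|orbit 'P H x| = orbit_size m j e.
  exact: card_orbit_cyclic_2group m_gt1 cycG oG os ot defA s4 s_a oa.
have order2 (x : gT) : {e | #[x]%g = (2 ^ e)%N & (e <= m)%N}.
  exists (logn 2 #[x]%g); have : (#[x]%g %| 2 ^ m)%N by rewrite -oG order_dvdG ?inE.
    by case/(dvdn_pfactor _ _ (isT : prime 2)) => e _ ->; rewrite pfactorK.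
  by case/(dvdn_pfactor _ _ (isT : prime 2)) => e le_em ->; rewrite pfactorK.
have actsE (O : {set gT}) : [acts H, on O | 'P] = (('P^*)%act O a == O) && (O^-1 == O)%g.
  have astabsE (b : {perm gT}) : (b \in 'N(O | 'P)) = (('P^*)%act O b == O).
    by rewrite -astab1_set; apply/astab1P/eqP.
  rewrite join_subG !cycle_subG !astabsE; congr (_ && (_ == _)).
  have -> : ('P^*)%act O t = t @: O by [].
  by apply/setP=> x; rewrite inE -(mem_imset O _ (@perm_inj _ t)) tV invgK.
have D1 : orders_upto gT m = [set~ 1%g].
  apply/setP=> x; rewrite !inE -order_eq1; have [e -> le_em] := order2 x.
  by rewrite pfactorK // le_em andbT (eqn_exp2l _ 0) // lt0n.
pose St (S : {set gT}) := \sum_(O : {set gT} | (O \subset S) && [acts H, on O | 'P]) z ^+ #|O|.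
have St_prod n : (n <= m)%N -> St (orders_upto gT n) = 
    \prod_(1 <= e < n.+1) (1 + z ^+ orbit_size m j e) ^+ (2 ^ e.-1 %/ orbit_size m j e).
  move=> le_nm; rewrite /St sum_stable_subsets ?acts_orders_upto //.
  exact: prod_orbits_upto cycG oG le_nm sHA oorb.
transitivity (St (orders_upto gT m) - St (orders_upto gT m.-1)); last first.
  rewrite !St_prod ?leq_pred // prednK // big_nat_recr //= /stable_weight.
  by rewrite mulrBl mul1r [in LHS]mulrC.
apply/eqP; rewrite -subr_eq opprK eq_sym; apply/eqP.
rewrite /St (bigID (fun O : {set gT} => O \subset orders_upto gT m.-1)) /= addrC; congr (_ + _).
  apply: eq_bigl => O; rewrite actsE D1 subsetC sub1set !inE.
  rewrite (cyclic_pgroup_gen O _ m_gt0 cycG oG) //.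
  have [_ | O1] := boolP (1%g \in O); rewrite ?andbF //= andbT.
  rewrite [RHS]andbC andbA; congr (_ && _); apply/subsetPn/existsP => -[x]; last first.
    case/andP=> Ox /eqP ox; exists x => //.
    by rewrite inE ox pfactorK // m_gt0 -ltnNge prednK.
  (* A point outside [orders_upto gT m.-1] has order 1 or [2 ^ m]; the first is impossible since 1
     is not in [O]. *)
  move=> Ox; rewrite inE negb_and -leqNgt -(ltnNge m.-1) => xhigh; exists x; rewrite Ox.
  have [e ox le_em] := order2 x; rewrite ox pfactorK // leqn0 prednK // in xhigh.
  rewrite /= ox eqn_exp2l // eqn_leq le_em.
  case/orP: xhigh => // /eqP e0; case/negP: O1.
  by move: ox; rewrite e0 => /eqP; rewrite order_eq1 => /eqP<-.
apply: eq_bigl => O; rewrite andbAC; congr (_ && _); apply/andP/idP => [[] // | sO].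
split=> //; apply: subset_trans sO _; apply/subsetP=> x; rewrite !inE.
by case/andP=> -> /leq_trans-> //; apply: leq_pred.
Qed.

(** * Summation over the automorphism group *)

Lemma sum_cycle_logn_order {gT : finGroupType} {s : gT} {n} (R : nzSemiRingType) (W : nat -> R) :
    #[s]%g = (2 ^ n)%N ->
  \sum_(a in <[s]>%g) W (logn 2 #[a]%g) = \sum_(j < n.+1) (totient (2 ^ j))%:R * W j.
Proof.
move=> os; have order2 a : a \in <[s]>%g -> exists2 e, #[a]%g = (2 ^ e)%N & (e < n.+1)%N.
  move=> s_a; have : (#[a]%g %| 2 ^ n)%N by rewrite -os order_dvdG.
  by case/(dvdn_pfactor _ _ (isT : prime 2)) => e le_en ->; exists e.
(* The default value of [inord] never occurs: the exponent of an order in [<[s]>] is at most [n]. *)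
rewrite (partition_big (fun a => inord (logn 2 #[a]%g) : 'I_n.+1) xpredT) //=.
apply: eq_bigr => j _; rewrite (eq_bigr (fun=> W j)) => [|a /andP[s_a /eqP<-]]; last first.
  by have [e -> lt_en] := order2 a s_a; rewrite pfactorK // inordK.
rewrite sumr_const mulr_natl; congr (_ *+ _).
rewrite -(card_order_cyclic (cycle_cyclic s)); last first.
  by rewrite -orderE os dvdn_exp2l // -ltnS.
apply: eq_card => a; rewrite [RHS]inE [LHS]unfold_in; case s_a: (a \in _) => //=.
have [e -> lt_en] := order2 a s_a; rewrite pfactorK // eqn_exp2l //.
by rewrite -val_eqE /= inordK.
Qed.

Lemma Psiw_cyclic_2group {gT : finGroupType} {m} :
    (1 < m)%N -> cyclic [set: gT] -> #|[set: gT]| = (2 ^ m)%N ->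
  (2 ^ (m - 2))%:R * Psiw gT =
    \sum_(j < m.-1) (totient (2 ^ j))%:R * stable_weight _ m j 'X.
Proof.
move=> m_gt1 cycG oG.
have [s [t [os ot defA tV s4]]] := Aut_cyclic_2group_gens _ _ m_gt1 cycG oG.
have [_ defst cst ti_st] := dprodP defA.
pose F a : {poly int} := \sum_(O in Gsets gT | ('P^*)%act O a == O) 'X^#|O|.
have F_s a : a \in <[s]>%g -> F a = stable_weight _ m (logn 2 #[a]%g) 'X.
  move=> s_a; apply: (sum_fixed_Gsets _ _ m_gt1 cycG oG os ot defA tV s4 s_a).
  have : (#[a]%g %| 2 ^ (m - 2))%N by rewrite -os order_dvdG.
  by case/(dvdn_pfactor _ _ (isT : prime 2)) => e _ ->; rewrite pfactorK.
(* Inversion fixes every symmetric set, so [a * t] and [a] fix the same members of [Gsets gT]. *)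
have F_t a : F (a * t)%g = F a.
  apply: eq_bigl => O; rewrite !inE; case: (O^-1 =P O)%g => //= OV; congr (_ && _).
  have tO : t \in 'C[O | 'P^*]%g.
    apply/astab1P; have -> : ('P^*)%act O t = t @: O by [].
    by rewrite (eq_imset _ tV) -[RHS]OV; apply/setP=> x; rewrite inE;
       apply/imsetP/idP => [[y Oy ->] | Ox]; [rewrite invgK | exists x^-1%g; rewrite ?invgK].
  have fixE b : (('P^*)%act O b == O) = (b \in 'C[O | 'P^*])%g by apply/eqP/astab1P.
  by rewrite !fixE groupMr.
have cardA : #|Aut [set: gT]| = (2 ^ (m - 2)).*2.
  by rewrite -defst TI_cardMg // -!orderE os ot muln2.
have sumA : \sum_(a in Aut [set: gT]) F a = (\sum_(a in <[s]>%g) F a) *+ 2.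
  have At : t \in Aut [set: gT] by rewrite -cycle_subG -defst mulG_subr.
  have nst : t \notin <[s]>%g.
    apply/negP=> s_t; have : t \in (<[s]> :&: <[t]>)%g by rewrite inE s_t cycle_id.
    by rewrite ti_st inE -order_eq1 ot.
  have tt : (t * t = 1)%g by rewrite -(expg_order t) ot.
  have sAs : {subset <[s]>%g <= Aut [set: gT]}.
    by apply/subsetP; rewrite -defst mulG_subl.
  have memA a : a \in Aut [set: gT] -> (a \notin <[s]>%g) = ((a * t)%g \in <[s]>%g).
    rewrite -defst => /mulsgP[b c s_b t_c ->].
    have /cyclePmin[[|[|i]]] := t_c; rewrite ot // => _ ->.
      by rewrite mulg1 s_b groupMl // (negPf nst).
    by rewrite expg1 -mulgA tt mulg1 s_b groupMl // nst.
  rewrite (bigID (mem <[s]>%g)) /= mulr2n; congr (_ + _).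
    by apply: eq_bigl => a; apply: andb_idl => /sAs.
  (* Right translation by [t] maps [<[s]>] onto its other coset in [Aut]. *)
  rewrite (reindex_inj (mulIg t)) /=; apply: eq_big => [a | a _]; last exact: F_t.
  rewrite groupMr //; case Aa: (a \in Aut _) => /=.
    by rewrite memA -?mulgA ?tt ?mulg1 // groupM.
  by apply/esym; apply: contraFF Aa => /sAs.
have gT_gt1 : (1 < #|gT|)%N by rewrite -cardsT oG -{1}(expn0 2) ltn_exp2l // ltnW.
have := Psiw_burnside _ gT_gt1; rewrite -/F sumA cardA -muln2 natrM mulrAC -[RHS]mulr_natr.
have nz2 : 2%:R != 0 :> {poly int} by rewrite -polyC_natr polyC_eq0.
move=> eq2; rewrite (mulIf nz2 eq2) (eq_bigr _ F_s).
rewrite (sum_cycle_logn_order _ (fun j => stable_weight _ m j 'X) os).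
by rewrite (_ : (m - 2).+1 = m.-1)%N //; lia.
Qed.

(** * The explicit formula and its value at 1 *)

Lemma stable_weightE (R : comNzRingType) m (j : 'I_m.-1) (z : R) :
  stable_weight R m j z =
    ((1 + z ^+ (2 ^ j.+1)) ^+ (2 ^ (m - j - 2)) - 1) * (1 + z)
     * \prod_(j.+1 <= s < m.-1) (1 + z ^+ 2) ^+ (2 ^ (m - s - 2))
     * \prod_(1 <= s < j.+1) (1 + z ^+ (2 ^ (j - s + 1))) ^+ (2 ^ (m - j - 2)).
Proof.
case: j => j /= lt_jm; rewrite /stable_weight.
(* The division is exact: [j <= m - 2] keeps the exponent of the orbit size at most [e.-1]. *)
have sizeE e : (1 < e <= m)%N -> (1 + z ^+ orbit_size m j e) ^+ (2 ^ e.-1 %/ orbit_size m j e)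
    = (1 + z ^+ (2 ^ (1 + (j - (m - e))))) ^+ (2 ^ (e.-1 - (1 + (j - (m - e))))).
  move=> e_m; rewrite /orbit_size ifF; last by lia.
  by rewrite -expnB //; lia.
rewrite sizeE; last by lia.
rewrite big_ltn; last by lia.
have -> : (1 + z ^+ orbit_size m j 1) ^+ (2 ^ 1.-1 %/ orbit_size m j 1) = 1 + z.
  by rewrite /orbit_size eqxx.
rewrite -!mulrA; congr (_ * (_ * _)).
  by congr ((1 + z ^+ (2 ^ _)) ^+ (2 ^ _) - 1); lia.
(* Reindexing by [s = m - e], cut at [j]: orbits have size 2 for [s > j] and [2 ^ (j - s + 1)] for
   [s <= j]. *)
rewrite big_nat_rev big_add1 /= (big_cat_nat _ (n := j.+1)) //=.
rewrite mulrC; congr (_ * _); apply: eq_big_nat => i ij.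
  rewrite sizeE; last by lia.
  by congr ((1 + z ^+ _) ^+ (2 ^ _)); [rewrite (_ : (1 + _ = 1)%N) //|]; lia.
rewrite sizeE; last by lia.
by congr ((1 + z ^+ (2 ^ _)) ^+ (2 ^ _)); lia.
Qed.

Lemma horner_Psiw1 (gT : finGroupType) : (Psiw gT).[1] = (Ew gT)%:R.
Proof.
rewrite /Psiw /Ew horner_sum natr_sum; apply: eq_bigr => k _.
by rewrite hornerZ hornerXn expr1n mulr1.
Qed.

(* 'Z_(2^m) (m >= 2) with its additive finGroupType structure. *)
Theorem theorem4p2 (m : nat) (hm : (2 <= m)%N) :
  (2 ^ (m - 2))%:R * Psiw ('Z_(2 ^ m) : finGroupType) =
    \sum_(t < m.-1)
      (totient (2 ^ t))%:R *
      (((1 + 'X^(2 ^ t.+1)) ^+ (2 ^ (m - t - 2)) - 1) * (1 + 'X)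
       * \prod_(t.+1 <= s < m.-1) (1 + 'X^2) ^+ (2 ^ (m - s - 2))
       * \prod_(1 <= s < t.+1) (1 + 'X^(2 ^ (t - s + 1))) ^+ (2 ^ (m - t - 2)))
  /\
  ((Ew ('Z_(2 ^ m) : finGroupType))%:R : rat) =
    (Psiw ('Z_(2 ^ m) : finGroupType)).[1] %:~R
  /\
  ((Ew ('Z_(2 ^ m) : finGroupType))%:R : rat) =
    1 / (2 ^ (m - 2))%:R *
    \sum_(t < m.-1)
      (totient (2 ^ t))%:R *
      (((2 ^ (1 + 2 ^ (m - t - 2)))%:R - 2)
       * \prod_(t.+1 <= s < m.-1) (2 ^ (2 ^ (m - s - 2)))%:R
       * \prod_(1 <= s < t.+1) (2 ^ (2 ^ (m - t - 2)))%:R).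
Proof.
set gT : finGroupType := 'Z_(2 ^ m).
have cycG : cyclic [set: gT] by apply/cyclicP; exists Zp1; apply: Zp_cycle.
(* ['Z_n] has [n] elements only for [n > 1], whence the bound on [2 ^ m]. *)
have oG : #|[set: gT]| = (2 ^ m)%N.
  by rewrite cardsT card_ord Zp_cast // -{1}(expn0 2) ltn_exp2l // ltnW.
have formula := Psiw_cyclic_2group hm cycG oG.
rewrite horner_Psiw1; split; last split.
- by rewrite formula; apply: eq_bigr => t _; rewrite stable_weightE.
- by rewrite rmorph_nat.
(* Evaluation at 1 followed by the embedding of the integers is a ring morphism, so it passes
   through the sums and products of the polynomial identity. *)
pose ev1 : {rmorphism {poly int} -> rat} := intr \o horner_eval 1.
have ev1X : ev1 'X = 1 by rewrite /= /horner_eval hornerX.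
have ev1Psi : ev1 (Psiw gT) = (Ew gT)%:R.
  by rewrite /= /horner_eval horner_Psiw1 rmorph_nat.
have nz2 : (2 ^ (m - 2))%:R != 0 :> rat by rewrite Num.Theory.pnatr_eq0 expn_eq0.
apply: (mulfI nz2); rewrite mulrA mulrA mulr1 divff // mul1r.
rewrite -ev1Psi -(rmorph_nat ev1) -rmorphM formula rmorph_sum.
apply: eq_bigr => t _; rewrite rmorphM rmorph_nat stable_weightE; congr (_ * _).
have powE a b : ev1 ((1 + 'X^a) ^+ b) = (2 ^ b)%:R.
  by rewrite rmorphXn rmorphD rmorph1 rmorphXn ev1X expr1n natrX.
rewrite !rmorphM !rmorph_prod rmorphB rmorphD rmorph1 ev1X powE.
congr (_ * _ * _); last 2 first.
- by apply: eq_bigr => s _; rewrite powE.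
- by apply: eq_bigr => s _; rewrite powE.
(* The factor [1 + 'X] takes the value 2 and is absorbed into the difference. *)
by rewrite expnS natrM mulrBl mul1r mulrC.
Qed.
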